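(* Let $\lambda>0$ and $0<p<1$ be real. Then for all $z>1$, $$\int \frac{1}{(z-x)^{\lambda}}\,\mu_{p\lambda-1,\,(1-p)\lambda-1}(dx) = \left[\frac{1}{(z-1)^{1-p}(z+1)^{p}}\right]^{\lambda} = \left[\int \frac{1}{z-x}\,\mu_{p-1,\,-p}(dx)\right]^{\lambda}.$$
   Context: For $\gamma,\beta>-1$, $\mu_{\gamma,\beta}$ is the beta distribution on $[-1,1]$ given by $\mu_{\gamma,\beta}(dx) = \frac{\Gamma(\gamma+\beta+2)}{2^{\gamma+\beta+1}\Gamma(\gamma+1)\Gamma(\beta+1)}(1-x)^{\gamma}(1+x)^{\beta}\mathbf{1}_{[-1,1]}(x)\,dx$. *)

(* Defs.v *)
From HB Require Import structures.
From mathcomp Require Import all_boot all_order all_algebra.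
From mathcomp Require Import all_classical all_reals all_analysis measurable_realfun.
Set Implicit Arguments.
Unset Strict Implicit.
Unset Printing Implicit Defensive.
Import Order.TTheory GRing.Theory Num.Theory.
Import numFieldNormedType.Exports.
Local Open Scope classical_set_scope.
Local Open Scope ring_scope.

(* Euler's integral of the second kind; it is the Gamma function for s > 0.
   For s <= 0 the integral diverges and the value here is 0 (by fine). *)
Definition Gamma {R : realType} (s : R) : R :=
  \int[lebesgue_measure]_(t in `]0%R, +oo[) (t `^ (s - 1) * expR (- t)).

Lemma Gamma_ge0 {R : realType} (s : R) : 0 <= Gamma s.
Proof.
by apply: Rintegral_ge0 => t _; rewrite mulr_ge0 ?powR_ge0 ?expR_ge0.
Qed.

Section jacobi_beta.
Context {R : realType} (gamma beta : R).
Notation leb := (@lebesgue_measure R).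

(* At x = -1, 1 a negative power takes the value 0 `^ _ = 0 instead of being
   infinite; this only concerns a Lebesgue-null set. *)
Definition beta_density (x : R) : R :=
  Gamma (gamma + beta + 2) /
    (2 `^ (gamma + beta + 1) * Gamma (gamma + 1) * Gamma (beta + 1))
  * (1 - x) `^ gamma * (1 + x) `^ beta * \1_(`[-1, 1]%classic) x.

Lemma beta_density_ge0 x : 0 <= beta_density x.
Proof.
by rewrite !mulr_ge0 ?powR_ge0 ?invr_ge0 ?mulr_ge0 ?Gamma_ge0 ?powR_ge0.
Qed.

Lemma measurable_beta_density : measurable_fun setT beta_density.
Proof.
apply: measurable_funM; last exact: measurable_indic.
apply: measurable_funM.
  apply: measurable_funM => //.
  apply: (measurableT_comp (measurable_powR gamma)) => //.
  exact: measurable_funB.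
apply: (measurableT_comp (measurable_powR beta)) => //.
exact: measurable_funD.
Qed.

(* The beta distribution mu_{gamma, beta} on [-1, 1], meaningful for
   gamma, beta > -1. *)
Definition beta_measure (A : set (measurableTypeR R)) : \bar R :=
  (\int[leb]_(x in A) (beta_density x)%:E)%E.

Let beta_measure0 : beta_measure set0 = 0%E.
Proof. exact: integral_set0. Qed.

Let beta_measure_ge0 A : (0 <= beta_measure A)%E.
Proof. by apply: integral_ge0 => x _; rewrite lee_fin beta_density_ge0. Qed.

Let beta_measure_sigma_additive : semi_sigma_additive beta_measure.
Proof.
move=> F mF tF mUF; apply: cvg_toP.
  apply: ereal_nondecreasing_is_cvgn => m n mn.
  by apply: lee_sum_nneg_natr => // k _ _; exact: beta_measure_ge0.
rewrite /beta_measure ge0_integral_bigcup//=.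
- apply/measurable_funTS/measurableT_comp => //.
  exact: measurable_beta_density.
- by move=> x _; rewrite lee_fin beta_density_ge0.
Qed.

HB.instance Definition _ := isMeasure.Build _ _ _ beta_measure
  beta_measure0 beta_measure_ge0 beta_measure_sigma_additive.

End jacobi_beta.

(* Main.v *)
Require Import Defs.
From HB Require Import structures.
From mathcomp Require Import all_boot all_order all_algebra.
From mathcomp Require Import all_classical all_reals all_analysis.
From mathcomp Require Import measurable_realfun ring lra.
Set Implicit Arguments.
Unset Strict Implicit.
Unset Printing Implicit Defensive.
Import Order.TTheory GRing.Theory Num.Theory.
Import numFieldNormedType.Exports.
Local Open Scope classical_set_scope.
Local Open Scope ring_scope.

(** Write a = p * lambda and b = (1 - p) * lambda, so that a + b = lambda.  The
    first equality is the beta integral in projective form: for A, B > 0,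
<<
      Gamma a * A^-a * Gamma b * B^-b
        = int_(s > 0) int_(t > 0) s^(a-1) t^(b-1) e^(-A s - B t) dt ds
        = Gamma (a+b) * int_(w > 0) w^(b-1) (A + B w)^-(a+b) dw,
>>
    where the second line is the substitution t = s w, then an exchange of the
    two integrals, then the Gamma integral in s ([integral_beta_prime]).  Take
    A = z + 1 and B = z - 1 and let x = (w - 1) / (w + 1) run through ]-1, 1[.
    Then A + B w = 2 (z - x) / (1 - x), and the last integral becomes the
    integral of (1-x)^(a-1) (1+x)^(b-1) (z-x)^-(a+b) up to a power of 2
    ([integral_beta_kernel]); the normalization of the beta density cancels all
    the remaining constants and leaves (z+1)^-a (z-1)^-b, the middle term.

    The second equality is the first one for the parameters p and 1 - p, whose
    sum is 1, raised to the power lambda.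

    The integrands are singular at the endpoints, so the changes of variables
    are made on compact subintervals and extended by monotone convergence
    ([ge0_integration_by_substitution0y]).  The value of Gamma is a real number
    extracted from an extended one, so the convergence of its integral has to be
    proved as well ([Gamma_integral]), and its positivity is needed in order to
    divide by it ([Gamma_gt0]). *)

(** * Change of variables from the positive half-line *)

Lemma itv0y_bigcup (R : realType) :
  `]0, +oo[%classic = \bigcup_n `[n.+1%:R^-1 : R, n.+1%:R]%classic.
Proof.
apply/seteqP; split => [x|x [n _]] /=; rewrite !in_itv/=; last first.
  by rewrite andbT => /andP[+ _]; apply: lt_le_trans; rewrite invr_gt0.
rewrite andbT => x0.
exists (Num.bound (Num.max x x^-1)) => //=; rewrite in_itv/=.
have : Num.max x x^-1 <= (Num.bound (Num.max x x^-1)).+1%:R.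
  have M0 : 0 <= Num.max x x^-1 by rewrite le_max ltW.
  by rewrite ltW// (lt_le_trans (archi_boundP M0))// ler_nat.
rewrite ge_max => /andP[-> xV]; rewrite andbT.
by rewrite -[leRHS]invrK lef_pV2// posrE// invr_gt0.
Qed.

Section substitution.
Context {R : realType}.
Local Notation mu := (@lebesgue_measure R).

(** The function [G] may blow up at both ends of [E]: on each segment
    [1/(n+1), n+1] everything is continuous up to the boundary, and since the
    integrands are nonnegative the segments exhaust both integrals. *)
Lemma ge0_integration_by_substitution0y (F f G : R -> R) (E : set R) :
  F @` `]0, +oo[ = E ->
  {in `]0, +oo[ &, {homo F : x y / x < y}} ->
  (forall x : R, 0 < x -> is_derive x 1 F (f x)) ->
  (forall x : R, 0 < x -> {for x, continuous f}) ->
  (forall y, E y -> {for y, continuous G}) ->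
  (forall y, E y -> 0 <= G y) ->
  (\int[mu]_(y in E) (G y)%:E =
   \int[mu]_(x in `]0%R, +oo[) (G (F x) * f x)%:E)%E.
Proof.
move=> FE Fincr dF cf cG G0.
pose a n : R := n.+1%:R^-1; pose b n : R := n.+1%:R.
have a0 n : 0 < a n by rewrite invr_gt0.
have ab n : a n <= b n by rewrite (@le_trans _ _ 1) ?invf_le1 ?ler1n.
have b0 n : 0 < b n by [].
have anti m n : (m <= n)%N -> a n <= a m.
  by move=> mn; rewrite lef_pV2 ?posrE ?ler_nat.
have monb m n : (m <= n)%N -> b m <= b n by move=> mn; rewrite ler_nat.
have incl (x y : R) : 0 < x -> x <= y -> F x <= F y.
  move=> x0; rewrite le_eqVlt => /predU1P[->//|xy]; apply/ltW/Fincr => //.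
    by rewrite in_itv/= x0.
  by rewrite in_itv/= (lt_trans x0).
have cF (x : R) : 0 < x -> {for x, continuous F}.
  by move=> /dF[dFx _]; apply/differentiable_continuous/derivable1_diffP.
have F'E (x : R) : 0 < x -> derive1 F x = f x.
  by move=> x0; rewrite derive1E; have [] := dF x x0.
have F'near (x : R) : 0 < x -> \forall y \near x, f y = derive1 F y.
  by move=> x0; near=> y; rewrite F'E//; near: y; exact: lt_nbhsr.
have cF' (x : R) : 0 < x -> derive1 F y @[y --> x] --> f x.
  by move=> x0; apply: cvg_trans (cf x x0); apply: near_eq_cvg; exact: F'near.
have segE n : `[F (a n), F (b n)]%classic `<=` E.
  move=> y /=; rewrite in_itv/= => yab.
  have [x] : exists2 x, x \in `[a n, b n] & F x = y.
    apply: IVT => //.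
      apply: continuous_in_subspaceT => x; rewrite inE/= in_itv/= => /andP[xa _].
      exact/cF/(lt_le_trans _ xa).
    by have Fab := incl _ _ (a0 n) (ab n); rewrite min_l// max_r.
  rewrite in_itv/= => /andP[ax xb] Fxy; rewrite -FE; exists x => //=.
  by rewrite in_itv/= andbT (lt_le_trans _ ax).
have Ebig : E = \bigcup_n `[F (a n), F (b n)]%classic.
  apply/seteqP; split; last by move=> y [n _]; exact: segE.
  rewrite -FE itv0y_bigcup => y [x [n _ /=] + <-].
  rewrite in_itv/= => /andP[ax xb].
  exists n => //=; rewrite in_itv/= !incl//.
  exact: lt_le_trans ax.
have step n : (\int[mu]_(y in `[F (a n), F (b n)]) (G y)%:E =
    \int[mu]_(x in `[a n, b n]) (G (F x) * f x)%:E)%E.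
  rewrite integration_by_substitution_increasing//.
  - apply: eq_integral => x; rewrite inE/= in_itv/= => /andP[ax _].
    by rewrite fctE/= F'E// (lt_le_trans _ ax).
  - move=> x y /[!in_itv]/= /andP[ax _] /andP[ay _]; apply: Fincr;
      by rewrite in_itv/= andbT (lt_le_trans _ (_ : a n <= _)).
  - move=> x /[!in_itv]/= /andP[ax _]; have x0 := lt_trans (a0 n) ax.
    by rewrite /continuous_at F'E//; exact: cF'.
  - by apply/cvg_ex; exists (f (a n)); apply: cvg_at_right_filter; exact: cF'.
  - by apply/cvg_ex; exists (f (b n)); apply: cvg_at_left_filter; exact: cF'.
  - split.
    + move=> x /[!in_itv]/= /andP[ax _].
      by have [] := dF x (lt_trans (a0 n) ax).
    + by apply: cvg_at_right_filter; exact: cF.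
    + by apply: cvg_at_left_filter; exact: cF.
  - by apply: continuous_in_subspaceT => y; rewrite inE => /segE; exact: cG.
have cGF (x : R) : 0 < x -> {for x, continuous (fun x => G (F x) * f x)}.
  move=> x0; apply: cvgM; last exact: cf.
  apply: (continuous_comp (cF x x0)); apply: cG; rewrite -FE.
  by exists x => //=; rewrite in_itv/= x0.
have cvL : (\int[mu]_(y in `[F (a n), F (b n)]) (G y)%:E @[n --> \oo] -->
     \int[mu]_(y in E) (G y)%:E)%E.
  rewrite Ebig; apply: ge0_nondecreasing_set_cvg_integral => //.
  - move=> m n mn; rewrite subsetEset; apply: subset_itv; rewrite bnd_simp;
      by apply: incl; rewrite ?anti ?monb.
  - move=> n; apply/measurable_EFinP.
    apply: subspace_continuous_measurable_fun => //.
    by apply: continuous_in_subspaceT => y; rewrite inE => /segE; exact: cG.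
  - by move=> n y /segE Ey; rewrite lee_fin G0.
have cvR : (\int[mu]_(x in `[a n, b n]) (G (F x) * f x)%:E @[n --> \oo] -->
     \int[mu]_(x in `]0%R, +oo[) (G (F x) * f x)%:E)%E.
  rewrite itv0y_bigcup; apply: ge0_nondecreasing_set_cvg_integral => //.
  - move=> m n mn; rewrite subsetEset; apply: subset_itv; rewrite bnd_simp;
      by rewrite ?anti ?monb.
  - move=> n; apply/measurable_EFinP.
    apply: subspace_continuous_measurable_fun => //.
    apply: continuous_in_subspaceT => y; rewrite inE/= in_itv/= => /andP[ay _].
    by apply: cGF; exact: lt_le_trans ay.
  - move=> n x /=; rewrite in_itv/= => /andP[ax _].
    have x0 : 0 < x by exact: lt_le_trans ax.
    rewrite lee_fin mulr_ge0//.
      by apply: G0; rewrite -FE; exists x => //=; rewrite in_itv/= x0.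
    rewrite -F'E//.
    apply: (@incr_derive1_ge0_itvy _ _ false 0).
    + by move=> y; rewrite inE/= in_itv/= andbT => /dF[].
    + exact: Fincr.
    + by rewrite in_itv/= x0.
have stepE := funext step; rewrite -stepE in cvR.
exact: (cvg_unique _ cvL cvR).
Unshelve. all: by end_near. Qed.

End substitution.

(** * The Gamma integral *)

Section gamma_integral.
Context {R : realType}.
Local Notation mu := (@lebesgue_measure R).

Lemma continuous_powR (a x : R) : 0 < x -> {for x, continuous (fun y : R => y `^ a)}.
Proof.
move=> x0; apply/differentiable_continuous/derivable1_diffP.
by have [] := is_derive1_powR a x0.
Qed.

Lemma is_derive_inv1D (x : R) : 0 < x ->
  is_derive x 1 (fun t => (1 + t)^-1) (- (1 + x) ^- 2).
Proof.
move=> x0.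
have d1 : is_derive x 1 (fun t : R => 1 + t) 1.
  by have := is_deriveD (is_derive_cst (1 : R) x 1) (is_derive_id x 1); rewrite add0r.
have nz : 1 + x != 0 by rewrite gt_eqF// addr_gt0.
by have := is_deriveV nz d1; rewrite [_ *: _]mulr1.
Qed.

Lemma continuous_inv1D (x : R) : 0 < x ->
  {for x, continuous (fun t : R => (1 + t)^-1)}.
Proof.
move=> /is_derive_inv1D[? _].
exact/differentiable_continuous/derivable1_diffP.
Qed.

(** This is 1 + u <= e^u at u = y / k - 1, raised to the power k. *)
Lemma powR_le_expR (k y : R) : 0 < k -> 0 <= y ->
  y `^ k <= k `^ k * expR (y - k).
Proof.
move=> k0 y0.
have -> : y `^ k = k `^ k * (y / k) `^ k.
  rewrite -powRM ?(ltW k0) ?divr_ge0 ?(ltW k0)//.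
  by rewrite mulrC divfK// gt_eqF.
rewrite ler_wpM2l ?powR_ge0//.
have -> : expR (y - k) = expR (y / k - 1) `^ k.
  by rewrite -expRM mulrBl mul1r divfK// gt_eqF.
rewrite ge0_ler_powR ?(ltW k0)// ?nnegrE ?expR_ge0 ?divr_ge0 ?(ltW k0)//.
by apply: le_trans (expR_ge1Dx _); rewrite addrC subrK.
Qed.

(** The right-hand side is, up to a constant, the derivative of the bounded
    function (t / (1 + t))^s: it has the singularity t^(s-1) at 0 and decays like
    t^-2, so it dominates the Gamma integrand at both ends at once. *)
Lemma gamma_integrand_le (s t : R) : 0 < s -> 0 < t ->
  t `^ (s - 1) * expR (- t) <=
  (s + 1) `^ (s + 1) * ((t / (1 + t)) `^ (s - 1) * (1 + t) ^- 2).
Proof.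
move=> s0 t0.
have t1 : 0 < 1 + t by rewrite addr_gt0.
have tn : 1 + t != 0 by rewrite gt_eqF.
have -> : t `^ (s - 1) = (t / (1 + t)) `^ (s - 1) * (1 + t) `^ (s - 1).
  by rewrite -powRM ?divfK// ?divr_ge0 ?(ltW t1) ?(ltW t0).
rewrite -mulrA [leRHS]mulrCA ler_wpM2l ?powR_ge0//.
rewrite ler_pdivlMr ?exprn_gt0// mulrAC.
have -> : (1 + t) `^ (s - 1) * (1 + t) ^+ 2 = (1 + t) `^ (s + 1).
  by rewrite -powR_mulrn ?(ltW t1)// -powRD; [congr (_ `^ _); ring|rewrite tn implybT].
rewrite expRN ler_pdivrMr ?expR_gt0//.
apply: (le_trans (powR_le_expR _ (ltW t1))); first by rewrite addr_gt0.
rewrite ler_wpM2l ?powR_ge0// ler_expR; lra.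
Qed.

Lemma continuous_gamma_integrand (s t : R) : 0 < t ->
  {for t, continuous (fun t : R => t `^ (s - 1) * expR (- t))}.
Proof.
move=> t0; apply: cvgM; first exact: continuous_powR.
by apply: continuous_comp; [exact: continuousN|exact: continuous_expR].
Qed.

Lemma measurable_gamma_integrand (s c : R) (D : set R) :
  measurable_fun D (fun t : R => t `^ (s - 1) * expR (- (c * t))).
Proof.
apply: measurable_funTS; apply: measurable_funM.
  exact: measurable_powR.
apply: measurableT_comp => //; apply: measurableT_comp => //.
Qed.

Lemma measurable_gamma_integrand1 (s : R) (D : set R) :
  measurable_fun D (fun t : R => t `^ (s - 1) * expR (- t)).
Proof.
rewrite (_ : (fun t => _) = (fun t : R => t `^ (s - 1) * expR (- (1 * t)))).
  exact: measurable_gamma_integrand.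
by apply/funext => t; rewrite mul1r.
Qed.

Lemma continuous_powR_sigmoid (s t : R) : 0 < t ->
  {for t, continuous (fun t : R => (t / (1 + t)) `^ (s - 1) * (1 + t) ^- 2)}.
Proof.
move=> t0; have t1 : 0 < 1 + t by rewrite addr_gt0.
have cV := continuous_inv1D t0.
apply: cvgM.
  apply: (@continuous_comp _ _ _ (fun t : R => t / (1 + t))
    (fun y : R => y `^ (s - 1))).
    by apply: cvgM => //; exact: cvg_id.
  by apply: continuous_powR; rewrite divr_gt0.
under eq_fun do rewrite -exprVn expr2; rewrite -exprVn expr2.
exact: cvgM.
Qed.

(** The map t |-> (t / (1 + t))^s carries the half-line increasingly onto ]0, 1[,
    so the integral of its derivative is the length of ]0, 1[. *)
Lemma integral_powR_sigmoid (s : R) : 0 < s ->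
  (\int[mu]_(t in `]0%R, +oo[) ((t / (1 + t)) `^ (s - 1) * (1 + t) ^- 2)%:E
   = (s^-1)%:E)%E.
Proof.
move=> s0.
pose H (t : R) := (t / (1 + t)) `^ s.
pose h (t : R) := s * ((t / (1 + t)) `^ (s - 1) * (1 + t) ^- 2).
have pow1 (r : R) : 1 `^ r = 1 :> R by rewrite powR1.
have posD (x : R) : 0 < x -> 0 < 1 + x by move=> ?; rewrite addr_gt0.
have sig0 (x : R) : 0 < x -> 0 < x / (1 + x).
  by move=> x0; rewrite divr_gt0 ?posD.
have sig1 (x : R) : 0 < x -> x / (1 + x) < 1.
  by move=> x0; rewrite ltr_pdivrMr ?posD// mul1r ltrDr.
have Himage : H @` `]0, +oo[ = `]0, 1[%classic.
  apply/seteqP; split => [y [x /=]|y /=]; rewrite !in_itv/= ?andbT.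
    move=> x0 <-; rewrite powR_gt0 ?sig0//=.
    rewrite -[ltRHS](pow1 s).
    by rewrite gt0_ltr_powR ?sig1// nnegrE ?ltW ?sig0.
  move=> /andP[y0 y1]; pose v := y `^ s^-1.
  have v0 : 0 < v by rewrite powR_gt0.
  have v1 : v < 1.
    rewrite -(pow1 s^-1).
    by rewrite gt0_ltr_powR ?invr_gt0 ?nnegrE ?(ltW y0).
  have v1' : 1 - v != 0 by rewrite subr_eq0 gt_eqF.
  (* v / (1 - v) is the preimage of v under t |-> t / (1 + t). *)
  exists (v / (1 - v)); first by rewrite in_itv/= andbT divr_gt0// subr_gt0.
  rewrite /H (_ : v / (1 - v) / _ = v); last by field; rewrite v1' subrK oner_neq0.
  by rewrite -powRrM mulVf ?gt_eqF// powRr1// ltW.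
have : (\int[mu]_(y in `]0%R, 1%R[) (cst 1 y)%:E =
    \int[mu]_(t in `]0%R, +oo[) (cst 1 (H t) * h t)%:E)%E.
  apply: ge0_integration_by_substitution0y => //.
  - move=> x y /[!in_itv]/=/[!andbT] x0 y0 xy.
    rewrite gt0_ltr_powR ?nnegrE ?ltW ?sig0//.
    by rewrite ltr_pdivrMr ?posD// mulrAC ltr_pdivlMr ?posD//; nra.
  - move=> x x0.
    have dsig : is_derive x 1 (fun t : R => t / (1 + t)) ((1 + x) ^- 2).
      apply: (is_derive_eq (is_deriveM (is_derive_id x 1) (is_derive_inv1D x0))).
      rewrite /GRing.scale/=.
      by field; rewrite gt_eqF ?posD.
    have dp := is_derive1_powR s (sig0 _ x0).
    have := @is_derive1_comp _ (fun y : R => y `^ s)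
      (fun t : R => t / (1 + t)) x _ _ dp dsig.
    by rewrite /h -mulrA.
  - move=> x x0; apply: cvgM; first exact: cvg_cst.
    exact: continuous_powR_sigmoid.
  - by move=> y _; exact: cst_continuous.
under [in X in _ = X -> _]eq_integral do rewrite /= mul1r EFinM.
rewrite ge0_integralZl_EFin//; last 3 first.
- move=> t; rewrite /= in_itv/= andbT => t0.
  by rewrite lee_fin mulr_ge0 ?powR_ge0// invr_ge0 exprn_ge0// ltW// posD.
- apply/measurable_EFinP; apply: open_continuous_measurable_fun => // t.
  by rewrite inE/= in_itv/= andbT; exact: continuous_powR_sigmoid.
- exact: ltW.
rewrite (integral_cst mu _ 1%:E)//= lebesgue_measure_itv/= lte_fin ltr01 sube0 mule1 => e.
by rewrite -[RHS]mule1 e muleA -EFinM mulVf ?gt_eqF// mul1e.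
Qed.

(** Since [Gamma] is defined with [fine], this says that the integral
    converges. *)
Lemma Gamma_integral (s : R) : 0 < s ->
  (\int[mu]_(t in `]0%R, +oo[) (t `^ (s - 1) * expR (- t))%:E = (Gamma s)%:E)%E.
Proof.
move=> s0; rewrite /Gamma /Rintegral fineK// ge0_fin_numE; last first.
  by apply: integral_ge0 => t _; rewrite lee_fin mulr_ge0 ?powR_ge0 ?expR_ge0.
pose g t := (s + 1) `^ (s + 1) * ((t / (1 + t)) `^ (s - 1) * (1 + t) ^- 2).
have mg : measurable_fun `]0:R, +oo[%classic
    (fun t : R => (t / (1 + t)) `^ (s - 1) * (1 + t) ^- 2).
  apply: open_continuous_measurable_fun => // t.
  by rewrite inE/= in_itv/= andbT; exact: continuous_powR_sigmoid.
apply: (@le_lt_trans _ _ (\int[mu]_(t in `]0%R, +oo[) (g t)%:E)%E).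
  apply: ge0_le_integral => //.
  - by move=> t _; rewrite lee_fin mulr_ge0 ?powR_ge0 ?expR_ge0.
  - apply/measurable_EFinP; exact: measurable_gamma_integrand1.
  - by apply/measurable_EFinP/measurable_funM.
  - move=> t; rewrite /= in_itv/= andbT => t0.
    by rewrite lee_fin gamma_integrand_le.
under eq_integral do rewrite EFinM.
rewrite ge0_integralZl_EFin//.
- by rewrite integral_powR_sigmoid// -EFinM ltry.
- move=> t; rewrite /= in_itv/= andbT => t0.
  by rewrite lee_fin mulr_ge0 ?powR_ge0// invr_ge0 exprn_ge0// addr_ge0// ltW.
- exact/measurable_EFinP.
- exact: powR_ge0.
Qed.

Lemma Gamma_gt0 (s : R) : 0 < s -> 0 < Gamma s.
Proof.
move=> s0; rewrite -lte_fin -Gamma_integral//.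
(* On [1, 2], 0 <= ln t <= 1 and t <= 2, which bounds the integrand below by c. *)
pose c := expR (- `|s - 1| - 2).
apply: (@lt_le_trans _ _ (\int[mu]_(t in `[1%R, 2%R]) c%:E)%E).
  rewrite integral_cst//= lebesgue_measure_itv/= lte_fin ltr1n -EFinD -EFinM.
  by rewrite lte_fin mulr_gt0 ?expR_gt0//; lra.
have sub : `[1, 2]%classic `<=` `]0 : R, +oo[%classic.
  by move=> t /=; rewrite !in_itv/= andbT => /andP[t1 _]; exact: lt_le_trans t1.
have mG D : measurable_fun D (fun t : R => (t `^ (s - 1) * expR (- t))%:E).
  apply/measurable_EFinP; exact: measurable_gamma_integrand1.
apply: (@le_trans _ _
  (\int[mu]_(t in `[1%R, 2%R]) (t `^ (s - 1) * expR (- t))%:E)%E).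
  apply: ge0_le_integral => //.
    by move=> t _; rewrite lee_fin expR_ge0.
    exact: mG.
  move=> t; rewrite /= in_itv/= => /andP[t1 t2]; rewrite lee_fin.
  have t0 : 0 < t by exact: lt_le_trans t1.
  rewrite /powR gt_eqF// -expRD ler_expR.
  have ln0 : 0 <= ln t by rewrite ln_ge0.
  have ln1 : ln t <= 1.
    by rewrite -ler_expR lnK ?posrE// (le_trans t2)//; have := expR_ge1Dx (1:R); lra.
  have : - `|s - 1| <= (s - 1) * ln t.
    rewrite lerNl -mulNr; apply: (le_trans (ler_norm _)).
    by rewrite normrM normrN (ger0_norm ln0) ler_piMr.
  lra.
apply: ge0_subset_integral => //; first exact: mG.
move=> t _.
by rewrite lee_fin mulr_ge0 ?powR_ge0 ?expR_ge0.
Qed.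

Lemma ge0_integral_dilation (c : R) (G : R -> R) : 0 < c ->
  (forall y : R, 0 < y -> {for y, continuous G}) ->
  (forall y, 0 < y -> 0 <= G y) ->
  (\int[mu]_(y in `]0%R, +oo[) (G y)%:E =
   \int[mu]_(x in `]0%R, +oo[) (G (c * x) * c)%:E)%E.
Proof.
move=> c0 cG G0.
apply: (@ge0_integration_by_substitution0y _ ( *%R c) (cst c)).
- apply/seteqP; split => [y [x /=]|y]/=; rewrite !in_itv/= !andbT.
    by move=> x0 <-; rewrite mulr_gt0.
  move=> y0; exists (c^-1 * y); rewrite ?in_itv/= ?andbT ?mulr_gt0 ?invr_gt0//.
  by rewrite mulVKf// gt_eqF.
- by move=> x y _ _ xy; rewrite ltr_pM2l.
- move=> x _; have /is_derive_eq := is_deriveZ c (is_derive_id x (1 : R)).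
  by apply; rewrite -[RHS]mulr1.
- by move=> x _; exact: cst_continuous.
- by move=> y /=; rewrite in_itv/= andbT; exact: cG.
- by move=> y /=; rewrite in_itv/= andbT; exact: G0.
Qed.

Lemma integral_powR_expR (s c : R) : 0 < s -> 0 < c ->
  (\int[mu]_(t in `]0%R, +oo[) (t `^ (s - 1) * expR (- (c * t)))%:E =
   (Gamma s * c `^ (- s))%:E)%E.
Proof.
move=> s0 c0.
have cs0 : 0 < c `^ s by rewrite powR_gt0.
have := Gamma_integral s0.
rewrite (ge0_integral_dilation c0)/=; last 2 first.
- by move=> y; exact: continuous_gamma_integrand.
- by move=> y _; rewrite mulr_ge0 ?powR_ge0 ?expR_ge0.
have -> : (\int[mu]_(x in `]0%R, +oo[) ((c * x) `^ (s - 1) * expR (- (c * x)) * c)%:E =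
   (c `^ s)%:E * \int[mu]_(t in `]0%R, +oo[) (t `^ (s - 1) * expR (- (c * t)))%:E)%E.
  rewrite -ge0_integralZl_EFin//.
  - apply: eq_integral => t; rewrite inE/= in_itv/= andbT => t0.
    rewrite -EFinM powRM ?(ltW c0) ?(ltW t0)//.
    by rewrite -(mulr_powRB1 (ltW c0) s0); congr (_%:E); ring.
  - by move=> t _; rewrite lee_fin mulr_ge0 ?powR_ge0 ?expR_ge0.
  - apply/measurable_EFinP; exact: measurable_gamma_integrand.
  - exact: powR_ge0.
move=> h; rewrite mulrC EFinM -h muleA -EFinM powRN mulVf ?mul1e//.
by rewrite gt_eqF.
Qed.

End gamma_integral.

(** * Integration against the beta distribution *)

Section beta_measure_integral.
Context {R : realType} (gamma beta : R).
Local Notation mu := (@lebesgue_measure R).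
Local Notation dens := (beta_density gamma beta).
Import HBNNSimple.

Let mdens D : measurable_fun D (fun x => (dens x)%:E).
Proof.
apply/measurable_EFinP; apply: measurable_funTS.
exact: measurable_beta_density.
Qed.

(** For an indicator function this is the definition of [beta_measure]; both
    sides are additive and positively homogeneous. *)
Lemma integral_beta_measure_nnsfun (h : {nnsfun (measurableTypeR R) >-> R}) :
  (\int[beta_measure gamma beta]_x (h x)%:E =
   \int[mu]_x ((h x)%:E * (dens x)%:E))%E.
Proof.
transitivity (\sum_(k \in range h) \int[mu]_x
    ((k * \1_(h @^-1` [set k]) x)%:E * (dens x)%:E))%E.
  rewrite integralT_nnsfun sintegralE; apply: eq_fsbigr => k.
  rewrite inE => -[t _ htk].
  have k0 : 0 <= k by rewrite -htk.
  under eq_integral do rewrite EFinM -muleA.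
  rewrite ge0_integralZl_EFin//.
  - congr (_ * _)%E.
    transitivity (\int[mu]_(x in h @^-1` [set k]) (dens x)%:E)%E => //.
    rewrite [LHS]integral_mkcond; apply: eq_integral => x _.
    rewrite patchE indicE; case: ifPn => _; rewrite ?mul1e ?mul0e//.
  - by move=> x _; rewrite mule_ge0 ?lee_fin ?beta_density_ge0.
  - apply: emeasurable_funM; last exact: mdens.
    apply/measurable_EFinP; exact: measurable_indic.
rewrite -ge0_integral_fsum//.
- apply: eq_integral => x _; rewrite fimfunE -fsumEFin//.
  rewrite ge0_mule_fsuml// => k; exact: nnfun_muleindic_ge0.
- move=> k; apply: emeasurable_funM; last exact: mdens.
  by apply/measurable_EFinP/measurable_funM.
- by move=> k x _; rewrite mule_ge0 ?nnfun_muleindic_ge0 ?lee_fin ?beta_density_ge0.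
Qed.

(** Monotone approximation by simple functions on both sides. *)
Lemma ge0_integral_beta_measure (f : measurableTypeR R -> \bar R) :
  measurable_fun setT f -> (forall x, 0 <= f x)%E ->
  (\int[beta_measure gamma beta]_x f x = \int[mu]_x (f x * (dens x)%:E))%E.
Proof.
move=> mf f0; pose g := nnsfun_approx measurableT mf.
have cvg x : (g n x)%:E @[n --> \oo] --> f x by exact: cvg_nnsfun_approx.
have nd x : nondecreasing_seq (fun n => (g n x)%:E).
  by move=> m n mn; rewrite lee_fin; exact/lefP/nd_nnsfun_approx.
transitivity (limn (fun n => \int[beta_measure gamma beta]_x (g n x)%:E))%E.
  rewrite -monotone_convergence//.
  - by apply: eq_integral => x _; apply/esym/cvg_lim.
  - by move=> n; exact/measurable_EFinP.
  - by move=> n x _; rewrite lee_fin.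
under eq_fun do rewrite integral_beta_measure_nnsfun.
rewrite -monotone_convergence//.
- apply: eq_integral => x _; apply/cvg_lim => //.
  exact: cvgeZr.
- by move=> n; apply: emeasurable_funM; [exact/measurable_EFinP|exact: mdens].
- by move=> n x _; rewrite mule_ge0 ?lee_fin ?beta_density_ge0//.
- move=> x _ m n mn; apply: lee_wpmul2r; first by rewrite lee_fin beta_density_ge0.
  exact: nd.
Qed.

End beta_measure_integral.

(** * The beta integral *)

(** Tonelli's theorem for f multiplied by the indicators of D1 and D2. *)
Lemma ge0_fubini_tonelli_in d1 d2 (T1 : measurableType d1)
    (T2 : measurableType d2) (R : realType)
    (m1 : {sigma_finite_measure set T1 -> \bar R})
    (m2 : {sigma_finite_measure set T2 -> \bar R})
    (D1 : set T1) (D2 : set T2) (f : T1 * T2 -> \bar R) :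
  measurable D1 -> measurable D2 ->
  measurable_fun setT f -> (forall x, 0 <= f x)%E ->
  (\int[m1]_(x in D1) \int[m2]_(y in D2) f (x, y) =
   \int[m2]_(y in D2) \int[m1]_(x in D1) f (x, y))%E.
Proof.
move=> mD1 mD2 mf f0.
pose g z := (f z * (\1_D1 z.1)%:E * (\1_D2 z.2)%:E)%E.
have gE x y : g (x, y) =
    if (x \in D1) && (y \in D2) then f (x, y) else 0%E.
  rewrite /g !indicE/=.
  by case: (x \in D1); case: (y \in D2); rewrite ?mule1 ?mule0 ?mul0e.
transitivity (\int[m1]_x \int[m2]_y g (x, y))%E.
  rewrite integral_mkcond; apply: eq_integral => x _.
  rewrite patchE; case: ifPn => [xD|xD].
    rewrite integral_mkcond; apply: eq_integral => y _.
    by rewrite patchE gE xD.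
  by rewrite integral0_eq// => y _; rewrite gE (negbTE xD).
rewrite fubini_tonelli.
- rewrite [RHS]integral_mkcond; apply: eq_integral => y _.
  rewrite patchE; case: ifPn => [yD|yD].
    rewrite [RHS]integral_mkcond; apply: eq_integral => x _.
    by rewrite patchE gE yD andbT.
  by rewrite integral0_eq// => x _; rewrite gE (negbTE yD) andbF.
- apply: emeasurable_funM.
    apply: emeasurable_funM => //; apply/measurable_EFinP.
    by apply: measurableT_comp; [exact: measurable_indic|exact: measurable_fst].
  apply/measurable_EFinP.
  by apply: measurableT_comp; [exact: measurable_indic|exact: measurable_snd].
- by move=> [x y]; rewrite gE; case: ifP.
Qed.

Section beta_integral.
Context {R : realType}.
Local Notation mu := (@lebesgue_measure R).

Lemma powR_gt0E (x r : R) : 0 < x -> x `^ r = expR (r * ln x).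
Proof. by move=> x0; rewrite /powR gt_eqF. Qed.

(** Both orders of integration of
    w^(b-1) s^(a+b-1) e^(-(A + B w) s) can be computed.  Integrating in s first is
    a Gamma integral of rate A + B w and gives the left-hand side times
    Gamma (a + b).  Integrating in w first, the dilation t = s w turns the inner
    integral into s^(a-1) e^(-A s) times a Gamma integral of rate B. *)
Lemma integral_beta_prime (a b A B : R) : 0 < a -> 0 < b -> 0 < A -> 0 < B ->
  (\int[mu]_(w in `]0%R, +oo[) (w `^ (b - 1) * (A + B * w) `^ (- (a + b)))%:E =
   (Gamma a * Gamma b / Gamma (a + b) * A `^ (- a) * B `^ (- b))%:E)%E.
Proof.
move=> a0 b0 A0 B0; have ab0 : 0 < a + b by rewrite addr_gt0.
pose f (x : R * R) :=
  x.1 `^ (b - 1) * (x.2 `^ (a + b - 1) * expR (- ((A + B * x.1) * x.2))).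
have f0 x : 0 <= f x by rewrite !mulr_ge0 ?powR_ge0 ?expR_ge0.
have mf : measurable_fun setT f.
  apply: measurable_funM.
    apply: (measurableT_comp (measurable_powR (b - 1))).
    exact: measurable_fst.
  apply: measurable_funM.
    apply: (measurableT_comp (measurable_powR (a + b - 1))).
    exact: measurable_snd.
  apply: measurableT_comp => //; apply: measurableT_comp => //.
  apply: measurable_funM; last exact: measurable_snd.
  by apply: measurable_funD => //; apply: measurable_funM.
have E1 : (\int[mu]_(w in `]0%R, +oo[) \int[mu]_(s in `]0%R, +oo[) (f (w, s))%:E =
    (Gamma (a + b))%:E * \int[mu]_(w in `]0%R, +oo[)
      (w `^ (b - 1) * (A + B * w) `^ (- (a + b)))%:E)%E.
  rewrite -ge0_integralZl_EFin//.
  - apply: eq_integral => w; rewrite inE/= in_itv/= andbT => w0.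
    under eq_integral do rewrite /f/= EFinM.
    rewrite ge0_integralZl_EFin ?powR_ge0//.
    + rewrite integral_powR_expR ?addr_gt0 ?mulr_gt0// -!EFinM.
      by congr EFin; ring.
    + by move=> s _; rewrite lee_fin mulr_ge0 ?powR_ge0 ?expR_ge0.
    + apply/measurable_EFinP; exact: measurable_gamma_integrand.
  - by move=> w _; rewrite lee_fin mulr_ge0 ?powR_ge0.
  - apply/measurable_EFinP; apply: measurable_funTS; apply: measurable_funM.
      exact: measurable_powR.
    apply: (measurableT_comp (measurable_powR (- (a + b)))).
    by apply: measurable_funD => //; exact: measurable_funM.
  - exact: Gamma_ge0.
have E2 : (\int[mu]_(s in `]0%R, +oo[) \int[mu]_(w in `]0%R, +oo[) (f (w, s))%:E =
    (Gamma b * B `^ (- b) * (Gamma a * A `^ (- a)))%:E)%E.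
  rewrite [RHS]EFinM -(integral_powR_expR a0 A0) -ge0_integralZl_EFin//.
  - apply: eq_integral => s; rewrite inE/= in_itv/= andbT => s0.
    rewrite -(integral_powR_expR b0 B0).
    rewrite [X in (X * _)%E](ge0_integral_dilation s0); last 2 first.
    + move=> y y0; apply: cvgM; first exact: continuous_powR.
      apply: (@continuous_comp _ _ _ (fun y : R => - (B * y)) expR).
        by apply: cvgN; apply: cvgM; [exact: cvg_cst|exact: cvg_id].
      exact: continuous_expR.
    + by move=> y _; rewrite mulr_ge0 ?powR_ge0 ?expR_ge0.
    rewrite muleC -ge0_integralZl_EFin//.
    + apply: eq_integral => w; rewrite inE/= in_itv/= andbT => w0.
      rewrite -EFinM /f/=; congr EFin.
      rewrite -[X in _ = _ * (_ * X)](powRr1 (ltW s0)).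
      rewrite !powR_gt0E ?mulr_gt0// lnM ?posrE// -!expRD.
      by congr expR; ring.
    + move=> w; rewrite /= in_itv/= andbT => w0.
      by rewrite lee_fin !mulr_ge0 ?powR_ge0 ?expR_ge0 ?ltW.
    + apply/measurable_EFinP; apply: measurable_funTS; apply: measurable_funM => //.
      apply: measurable_funM.
        apply: (measurableT_comp (measurable_powR (b - 1))).
        exact: measurable_funM.
      apply: measurableT_comp => //; apply: measurableT_comp => //.
      by apply: measurable_funM => //; exact: measurable_funM.
    + by rewrite mulr_ge0 ?powR_ge0 ?expR_ge0.
  - by move=> s _; rewrite lee_fin mulr_ge0 ?powR_ge0 ?expR_ge0.
  - apply/measurable_EFinP; exact: measurable_gamma_integrand.
  - by rewrite mulr_ge0 ?Gamma_ge0 ?powR_ge0.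
have G0 : Gamma (a + b) != 0 by rewrite gt_eqF ?Gamma_gt0.
have E3 : (\int[mu]_(w in `]0%R, +oo[) \int[mu]_(s in `]0%R, +oo[) (f (w, s))%:E =
   \int[mu]_(s in `]0%R, +oo[) \int[mu]_(w in `]0%R, +oo[) (f (w, s))%:E)%E.
  apply: (@ge0_fubini_tonelli_in _ _ _ _ R mu mu _ _ (EFin \o f)) => //.
  exact/measurable_EFinP.
rewrite E1 E2 in E3.
rewrite -[LHS]mul1e.
rewrite (_ : 1 = ((Gamma (a + b))^-1)%:E * (Gamma (a + b))%:E)%E.
  by rewrite -muleA E3 -EFinM; congr EFin; ring.
by rewrite -EFinM mulVf.
Qed.

(** The substitution is x = (w - 1) / (w + 1) = 1 - 2 u with u = 1 / (1 + w), for
    which 1 - x = 2 u, 1 + x = 2 w u, z - x = ((z + 1) + (z - 1) w) u and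
    dx = 2 u^2 dw: the powers of u cancel, and what is left is the integrand of
    [integral_beta_prime] for A = z + 1 and B = z - 1. *)
Lemma integral_beta_kernel (a b z : R) : 0 < a -> 0 < b -> 1 < z ->
  (\int[mu]_(x in `](-1)%R, 1%R[)
     ((1 - x) `^ (a - 1) * (1 + x) `^ (b - 1) * (z - x) `^ (- (a + b)))%:E =
   (2 `^ (a + b - 1) * (Gamma a * Gamma b / Gamma (a + b) *
     (z + 1) `^ (- a) * (z - 1) `^ (- b)))%:E)%E.
Proof.
move=> a0 b0 z1.
have zp : 0 < z + 1 by lra.
have zm : 0 < z - 1 by lra.
rewrite EFinM -integral_beta_prime// -ge0_integralZl_EFin ?powR_ge0//; last 2 first.
- by move=> w _; rewrite lee_fin mulr_ge0 ?powR_ge0.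
- apply/measurable_EFinP; apply: measurable_funTS; apply: measurable_funM.
    exact: measurable_powR.
  apply: (measurableT_comp (measurable_powR (- (a + b)))).
  by apply: measurable_funD => //; exact: measurable_funM.
have posD (w : R) : 0 < w -> 0 < 1 + w by move=> ?; rewrite addr_gt0.
etransitivity; first apply: (@ge0_integration_by_substitution0y _
  (fun w => 1 - 2 * (1 + w)^-1) (fun w => 2 * ((1 + w)^-1 * (1 + w)^-1))).
- apply/seteqP; split => [y [w /=]|y /=]; rewrite !in_itv/= ?andbT.
    move=> w0 <-; have w1 := posD _ w0.
    have u0 : 0 < (1 + w)^-1 by rewrite invr_gt0.
    have u1 : (1 + w)^-1 < 1 by rewrite invf_lt1// ltrDl.
    by apply/andP; split; lra.
  move=> /andP[y0 y1]; exists ((1 + y) / (1 - y)).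
    by rewrite in_itv/= andbT divr_gt0; lra.
  by field; apply/andP; split; rewrite ?gt_eqF//; lra.
- move=> x y /[!in_itv]/=/[!andbT] x0 y0 xy.
  rewrite ltrD2l ltrN2 ltr_pM2l// ltf_pV2 ?posrE ?posD//.
  by rewrite ltrD2l.
- move=> x x0.
  have := is_deriveB (is_derive_cst (1 : R) x 1) (is_deriveZ 2 (is_derive_inv1D x0)).
  by rewrite sub0r /GRing.scale/= mulrN opprK expr2 invfM.
- move=> x x0; have c := continuous_inv1D x0.
  by apply: cvgM; [exact: cvg_cst|exact: cvgM].
- move=> y /=; rewrite in_itv/= => /andP[y0 y1].
  have cB (c : R) : {for y, continuous (fun x : R => c - x)}.
    by apply: cvgB; [exact: cvg_cst|exact: cvg_id].
  have cD : {for y, continuous (fun x : R => 1 + x)}.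
    by apply: cvgD; [exact: cvg_cst|exact: cvg_id].
  apply: cvgM; first apply: cvgM.
  + apply: (@continuous_comp _ _ _ (fun x : R => 1 - x) (fun y => y `^ (a - 1))) => //.
    by apply: continuous_powR; lra.
  + apply: (@continuous_comp _ _ _ (fun x : R => 1 + x) (fun y => y `^ (b - 1))) => //.
    by apply: continuous_powR; lra.
  + apply: (@continuous_comp _ _ _ (fun x : R => z - x) (fun y => y `^ (- (a + b)))) => //.
    by apply: continuous_powR; lra.
- by move=> y _; rewrite !mulr_ge0 ?powR_ge0.
- apply: eq_integral => w; rewrite inE/= in_itv/= andbT => w0.
  rewrite -EFinM; congr EFin.
  have w1 := posD _ w0.
  have wn : 1 + w != 0 by rewrite gt_eqF.
  set u := (1 + w)^-1; have u0 : 0 < u by rewrite invr_gt0.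
  have -> : 1 - (1 - 2 * u) = 2 * u by ring.
  have -> : 1 + (1 - 2 * u) = 2 * (w * u) by rewrite /u; field.
  have -> : z - (1 - 2 * u) = (z + 1 + (z - 1) * w) * u by rewrite /u; field.
  have K0 : 0 < z + 1 + (z - 1) * w by rewrite addr_gt0// mulr_gt0.
  (* With every factor a power, taking logarithms makes the identity linear. *)
  have -> : 2 * (u * u) = 2 `^ 1 * (u `^ 1 * u `^ 1) by rewrite !powRr1 ?(ltW u0).
  rewrite !powR_gt0E ?mulr_gt0// !lnM ?posrE ?mulr_gt0//.
  by rewrite -!expRD; congr expR; ring.
Qed.

Lemma integral_beta_measure_powR (a b z : R) : 0 < a -> 0 < b -> 1 < z ->
  (\int[beta_measure (a - 1) (b - 1)]_x (((z - x) `^ (a + b))^-1)%:E =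
   ((z + 1) `^ (- a) * (z - 1) `^ (- b))%:E)%E.
Proof.
move=> a0 b0 z1.
have mzx (r : R) : measurable_fun setT (fun x : R => (z - x) `^ r).
  apply: (measurableT_comp (measurable_powR r)).
  exact: measurable_funB.
rewrite ge0_integral_beta_measure; last 2 first.
- apply/measurable_EFinP.
  under eq_fun do rewrite -powRN; exact: mzx.
- by move=> x; rewrite lee_fin invr_ge0 powR_ge0.
pose C := Gamma (a + b) / (2 `^ (a + b - 1) * Gamma a * Gamma b).
pose k (x : R) := (1 - x) `^ (a - 1) * (1 + x) `^ (b - 1) * (z - x) `^ (- (a + b)).
have mk : measurable_fun setT k.
  apply: measurable_funM => //; apply: measurable_funM.
    apply: (measurableT_comp (measurable_powR (a - 1))).
    exact: measurable_funB.
  apply: (measurableT_comp (measurable_powR (b - 1))).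
  exact: measurable_funD.
transitivity (\int[mu]_(x in `[(-1)%R, 1%R]) (C%:E * (k x)%:E))%E.
  rewrite [RHS]integral_mkcond; apply: eq_integral => x _.
  rewrite patchE /beta_density indicE; case: ifPn => _; last by rewrite mulr0 mule0.
  rewrite -!EFinM mulr1 /C /k powRN; congr EFin.
  have -> : a - 1 + (b - 1) + 2 = a + b by ring.
  have -> : a - 1 + (b - 1) + 1 = a + b - 1 by ring.
  by rewrite !subrK; ring.
rewrite integral_itv_bndoo; last first.
  by apply: emeasurable_funM => //; apply/measurable_EFinP/measurable_funTS.
have G := Gamma_gt0; have ab0 : 0 < a + b by rewrite addr_gt0.
rewrite ge0_integralZl_EFin//.
- rewrite (integral_beta_kernel a0 b0 z1) -EFinM; congr EFin; rewrite /C.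
  have Ga := lt0r_neq0 (G _ _ a0); have Gb := lt0r_neq0 (G _ _ b0).
  have Gab := lt0r_neq0 (G _ _ ab0).
  have t0 : 2 `^ (a + b - 1) != 0 :> R by rewrite gt_eqF ?powR_gt0.
  move: (Gamma a) (Gamma b) (Gamma (a + b)) (2 `^ _) Ga Gb Gab t0.
  by move=> ga gb gab t ga0 gb0 gab0 t0; field; rewrite ga0 gb0 gab0 t0.
- by move=> x _; rewrite lee_fin !mulr_ge0 ?powR_ge0.
- by apply/measurable_EFinP/measurable_funTS.
- by rewrite divr_ge0 ?mulr_ge0 ?Gamma_ge0 ?powR_ge0.
Qed.

Lemma ae_beta_measure_itv (gamma beta : R) :
  {ae beta_measure gamma beta, forall x, `[(-1), 1]%classic x}.
Proof.
exists (~` `[(-1), 1]%classic); split => //.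
  exact: measurableC.
rewrite [LHS]integral0_eq// => x /= nx.
by rewrite /beta_density indicE memNset// mulr0.
Qed.

(** [integral_beta_measure_powR] for exponents of sum 1.  The function 1 / (z - x)
    is negative for x > z, but there it only differs from the nonnegative
    ((z - x)^1)^-1 on a null set of the beta distribution. *)
Lemma integral_beta_measure_inv (p z : R) : 0 < p -> p < 1 -> 1 < z ->
  (\int[beta_measure (p - 1) (- p)]_x ((z - x)^-1)%:E =
   ((z + 1) `^ (- p) * (z - 1) `^ (- (1 - p)))%:E)%E.
Proof.
move=> p0 p1 z1; have q0 : 0 < 1 - p by rewrite subr_gt0.
rewrite -(integral_beta_measure_powR p0 q0 z1).
have -> : p + (1 - p) = 1 by ring.
have -> : 1 - p - 1 = - p by ring.
have mzB : measurable_fun setT (fun x : R => z - x) by exact: measurable_funB.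
apply: ae_eq_integral => //.
- apply/measurable_EFinP.
  (* 1 / y = y * (y^2)^-1 also holds at y = 0, and y^2 >= 0 makes the inverse a
     real power, hence a measurable function. *)
  rewrite (_ : (fun x => _) = (fun x : R => (z - x) * ((z - x) ^+ 2) `^ (- 1))).
    apply: measurable_funM => //.
    apply: (measurableT_comp (measurable_powR (- 1))).
    exact: measurable_funX.
  apply/funext => x; rewrite powR_inv1 ?sqr_ge0// expr2 invfM.
  have [->|nz] := eqVneq (z - x) 0; first by rewrite invr0 mul0r.
  by rewrite mulrA divff// mul1r.
- apply/measurable_EFinP; under eq_fun do rewrite -powRN.
  exact: (measurableT_comp (measurable_powR (- 1))).
- apply: filterS (ae_beta_measure_itv (p - 1) (- p)).
    exact: (ae_filter_ringOfSetsType (beta_measure (p - 1) (- p))).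
  move=> x /=.
  rewrite in_itv/= => /andP[_ x1] _.
  by rewrite powRr1// subr_ge0 (le_trans x1)// ltW.
Qed.

End beta_integral.

Unset Implicit Arguments.
Set Strict Implicit.

Theorem mainTheorem5 (R : realType) (lambda p : R)
    (hlambda : 0 < lambda) (hp0 : 0 < p) (hp1 : p < 1) :
  forall z : R, 1 < z ->
    (\int[beta_measure (p * lambda - 1) ((1 - p) * lambda - 1)]_x
        (((z - x) `^ lambda)^-1)%:E
      = ((((z - 1) `^ (1 - p) * (z + 1) `^ p)^-1) `^ lambda)%:E)%E
    /\
    (((((z - 1) `^ (1 - p) * (z + 1) `^ p)^-1) `^ lambda)%:E
      = (\int[beta_measure (p - 1) (- p)]_x ((z - x)^-1)%:E) `^ lambda)%E.
Proof.
move=> z z1; have q0 : 0 < 1 - p by rewrite subr_gt0.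
have zp : 0 < z + 1 by lra.
have zm : 0 < z - 1 by lra.
have invE : ((z - 1) `^ (1 - p) * (z + 1) `^ p)^-1 =
    (z + 1) `^ (- p) * (z - 1) `^ (- (1 - p)).
  by rewrite invfM -!powRN mulrC.
split; last by rewrite integral_beta_measure_inv// invE poweR_EFin.
have lE : p * lambda + (1 - p) * lambda = lambda by ring.
have := integral_beta_measure_powR (mulr_gt0 hp0 hlambda)
  (mulr_gt0 q0 hlambda) z1.
rewrite lE invE => ->.
by rewrite powRM ?powR_ge0// -!powRrM !mulNr.
Qed.
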